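(* Let $H$ be a colour Hopf algebra and $A$ a graded $H$-comodule colour algebra. Set $B=A^{coH}$. Assume that there is a graded $H$-colinear map $\theta:H\to A$ which is a homomorphism of colour algebras. Then for every colour $(A,H)$-Hopf module $M$, the map $$\alpha: A\otimes_B M^{coH}\to M,\qquad \alpha(a\otimes_B m)=am,$$ is an isomorphism of colour $(A,H)$-Hopf modules, where $A\otimes_B M^{coH}$ carries the $A$-action $a(a'\otimes_B m)=(aa')\otimes_B m$ and the $H$-coaction $a\otimes_B m\mapsto a_{(-1)}\otimes a_{(0)}\otimes_B m$.
   Context: $\Bbbk$ is a field and $G$ is a multiplicative abelian group with identity $e$ and a bicharacter $(\cdot/\cdot):G\times G\to\Bbbk^{\times}$, i.e. $(g/g'g'')=(g/g')(g/g'')$ and $(gg'/g'')=(g/g'')(g'/g'')$. ''Graded'' means $G$-graded; $|m|$ is the degree of a homogeneous element $m$; formulas are written for homogeneous elements and extended linearly. A graded map $f:M\to N$ is a $\Bbbk$-linear map with $f(M_g)\subseteq N_g$ for all $g$. $\otimes=\otimes_{\Bbbk}$, graded by $(M\otimes N)_g=\bigoplus_{g'g''=g}M_{g'}\otimes N_{g''}$; $\Bbbk$ is in degree $e$. A colour algebra is a $G$-graded associative unital $\Bbbk$-algebra; a homomorphism of colour algebras is a graded map that is a unital $\Bbbk$-algebra homomorphism. A colour Hopf algebra $H$ is a colour algebra which is also a (coassociative, counital) coalgebra with graded maps $\Delta_H$, $\varepsilon_H$ (write $\Delta_H(h)=h_1\otimes h_2$ with homogeneous components), such that $\varepsilon_H$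 is a unital algebra map, $\Delta_H(1_H)=1_H\otimes 1_H$, $\Delta_H(hh')=(|h_2|/|h'_1|)\,h_1h'_1\otimes h_2h'_2$, and with a graded map $\mathcal S_H:H\to H$ (antipode) satisfying $h_1\mathcal S_H(h_2)=\varepsilon_H(h)1_H=\mathcal S_H(h_1)h_2$. A graded $H$-comodule is a graded vector space $M$ with a graded map $\chi_M:M\to H\otimes M$, $\chi_M(m)=m_{(-1)}\otimes m_{(0)}$, which is coassociative and counital (left comodule). $H$ is a graded $H$-comodule via $\Delta_H$. A graded $H$-colinear map is a graded map $f$ with $f(m)_{(-1)}\otimes f(m)_{(0)}=m_{(-1)}\otimes f(m_{(0)})$. Coinvariants: $M^{coH}=\{m\in M:\chi_M(m)=1_H\otimes m\}$, a graded subspace. A graded $H$-comodule colour algebra is a colour algebra $A$ that is a graded $H$-comodule with $\chi_A(1_A)=1_H\otimes 1_A$ and $\chi_A(aa')=(|a_{(0)}|/|a'_{(-1)}|)\,a_{(-1)}a'_{(-1)}\otimes a_{(0)}a'_{(0)}$. A graded $A$-module is a graded vector space that is a left $A$-module with $A_gM_{g'}\subseteq M_{gg'}$. A colour $(A,H)$-Hopf module is a graded $A$-module and graded $H$-comodule $M$ (same grading) with $\chi_M(am)=(|a_{(0)}|/|m_{(-1)}|)\,a_{(-1)}m_{(-1)}\otimes a_{(0)}m_{(0)}$; morphisms are graded $A$-linear graded $H$-colinear maps. $B=A^{coH}$ is a graded subalgebra of $A$ and $M^{coH}$ is a graded left $B$-module. *)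

(* Defs.v *)
From HB Require Import structures.
From mathcomp Require Import all_boot all_algebra.
From mathcomp Require Import boolp classical_sets.
From mathcomp Require Import freeg.

Set Implicit Arguments.
Unset Strict Implicit.
Unset Printing Implicit Defensive.

Import GRing.Theory.
Local Open Scope ring_scope.
Local Open Scope quotient_scope.
Local Open Scope classical_set_scope.

Section LinearSpan.
Variables (k : fieldType) (V : lmodType k).

Definition lspan (S : set V) : set V :=
  [set v | exists2 s : seq (k * V),
     (forall p, p \in s -> S p.2) & v = \sum_(p <- s) p.1 *: p.2].

Definition lspan_pred (S : set V) : V -> bool := fun v => `[< lspan S v >].

Lemma lspan_sub (S : set V) v : S v -> lspan S v.
Proof.
move=> Sv; exists [:: (1, v)]; first by move=> p; rewrite inE => /eqP ->.
by rewrite big_seq1 scale1r.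
Qed.

Lemma lspan_submod (S : set V) : submod_closed (lspan_pred S).
Proof.
split=> [|a u v /asboolP[s sS ->] /asboolP[t tS ->]]; apply/asboolP.
  by exists [::] => //; rewrite big_nil.
exists ([seq (a * p.1, p.2) | p <- s] ++ t) => [p|].
  by rewrite mem_cat => /orP[/mapP[q qs ->]|/tS //]; exact: (sS q).
rewrite big_cat big_map scaler_sumr; congr (_ + _).
by apply: eq_bigr => p _; rewrite scalerA.
Qed.

HB.instance Definition _ (S : set V) :=
  GRing.isSubmodClosed.Build k V (lspan_pred S) (lspan_submod S).

Variable S : set V.

Definition lspan_zmod : zmodClosed V :=
  GRing.ZmodClosed.clone V (lspan_pred S) _.
Definition lquot : Type := Quotient.quot lspan_zmod.

HB.instance Definition _ := GRing.Zmodule.on lquot.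

Definition lpi (v : V) : lquot := \pi_(Quotient.quot lspan_zmod) v.
Definition lrepr (x : lquot) : V := repr (x : Quotient.quot lspan_zmod).

Lemma lreprK x : lpi (lrepr x) = x. Proof. exact: reprK. Qed.

Lemma lpi_eq u v : lpi u = lpi v <-> lspan S (u - v).
Proof.
rewrite /lpi; split=> [/eqP|uv].
  by rewrite -Quotient.idealrBE => /asboolP.
by apply/eqP; rewrite -Quotient.idealrBE; exact/asboolP.
Qed.

Lemma lpiD : {morph lpi : u v / u + v}.
Proof. by move=> u v; exact: Quotient.pi_add. Qed.

Definition lquot_scale (a : k) (x : lquot) : lquot := lpi (a *: lrepr x).

Lemma lpiZ_subproof a v : lquot_scale a (lpi v) = lpi (a *: v).
Proof.
apply/lpi_eq; rewrite -scalerBr -[a *: _]addr0; apply/asboolP.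
have [S0 Slin] := lspan_submod S; apply: Slin => //.
by apply/asboolP/lpi_eq; rewrite lreprK.
Qed.

Lemma lquot_scaleA a b x :
  lquot_scale a (lquot_scale b x) = lquot_scale (a * b) x.
Proof. by rewrite -[x]lreprK !lpiZ_subproof scalerA. Qed.

Lemma lquot_scale1 : left_id 1 lquot_scale.
Proof. by move=> x; rewrite -[x]lreprK lpiZ_subproof scale1r. Qed.

Lemma lquot_scaleDr : right_distributive lquot_scale +%R.
Proof.
move=> a x y; rewrite -[x]lreprK -[y]lreprK -lpiD !lpiZ_subproof.
by rewrite scalerDr lpiD.
Qed.

Lemma lquot_scaleDl x : {morph lquot_scale^~ x : a b / a + b}.
Proof. by move=> a b; rewrite -[x]lreprK !lpiZ_subproof scalerDl lpiD. Qed.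

HB.instance Definition _ := GRing.Zmodule_isLmodule.Build k lquot
  lquot_scaleA lquot_scale1 lquot_scaleDr lquot_scaleDl.

Lemma lpi_is_linear : linear lpi.
Proof. by move=> a u v; rewrite lpiD -lpiZ_subproof. Qed.

HB.instance Definition _ := GRing.isLinear.Build k V lquot *:%R lpi lpi_is_linear.

Lemma lpi_eq0 v : S v -> lpi v = 0.
Proof.
by move=> Sv; rewrite -(linear0 lpi); apply/lpi_eq; rewrite subr0; exact: lspan_sub.
Qed.

End LinearSpan.

Section Tensor.
Variable k : fieldType.

Definition bilin (M N P : lmodType k) (f : M -> N -> P) : Prop :=
  (forall n, linear (f^~ n)) /\ (forall m, linear (f m)).

Section Def.
Variables M N : lmodType k.

Definition free_pair (m : M) (n : N) : {freeg (M * N) / k} :=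
  Freeg [:: (1, (m, n))].

(* Their span is the kernel of the map from the free module to M ⊗ N. *)
Definition tensor_rel : set {freeg (M * N) / k} :=
  [set r | (exists a m m' n,
      r = free_pair (a *: m + m') n - (a *: free_pair m n + free_pair m' n)) \/
    (exists a m n n',
      r = free_pair m (a *: n + n') - (a *: free_pair m n + free_pair m n'))].

Definition tensor : lmodType k := lquot tensor_rel.

Definition tens (m : M) (n : N) : tensor := lpi tensor_rel (free_pair m n).

Lemma tens_bilin : bilin tens.
Proof.
split=> [n a m m'|m a n n']; rewrite /tens -linearP; apply/lpi_eq/lspan_sub.
  by left; exists a, m, m', n.
by right; exists a, m, n, n'.
Qed.

End Def.

(* The linear map with [tlift f (m ⊗ n) = f m n]; total in [f], and meaningful
   when [f] is bilinear: see [tlift_linear] and [tlift_tens]. *)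
Definition tlift (M N P : lmodType k) (f : M -> N -> P) (t : tensor M N) : P :=
  fglift (fun p => f p.1 p.2) (lrepr t).

Section Universal.
Variables M N P : lmodType k.

Lemma fglift_linear (K : choiceType) (f : K -> P) :
  linear (fglift f : {freeg K / k} -> P).
Proof.
have addf := lift_is_additive f.
have f0 : fglift f 0 = 0 by rewrite -(subrr 0) addf subrr.
have fD x y : fglift f (x + y) = fglift f x + fglift f y.
  by rewrite -[y in LHS]opprK -[- y]sub0r !addf f0 sub0r opprK.
move=> a x y; rewrite fD; congr (_ + _); rewrite -[x]freeg_sumE.
elim: (dom x) => [|z s IHs]; first by rewrite !big_nil scaler0 f0 scaler0.
rewrite !big_cons scalerDr !fD scalerDr IHs; congr (_ + _).
rewrite (_ : a *: _ = Freeg [:: (a * coeff z x, z)]).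
  by rewrite !liftU scalerA.
by apply/eqP/freeg_eqP => w; rewrite coeffZ !coeffU mulrA.
Qed.

Lemma tlift_pi (f : M -> N -> P) (fb : bilin f) (r : {freeg (M * N) / k}) :
  tlift f (lpi _ r) = fglift (fun p => f p.1 p.2) r.
Proof.
have lin := fglift_linear (fun p : M * N => f p.1 p.2).
set F : {freeg (M * N) / k} -> P := fglift _ in lin *.
have F0 : F 0 = 0 by have := lin (-1) 0 0; rewrite scaler0 addr0 scaleN1r addNr.
have FB (x y : {freeg (M * N) / k}) : F (x - y) = F x - F y by rewrite [x - y]addrC -(scaleN1r y) lin scaleN1r addrC.
apply/eqP; rewrite -subr_eq0 -/F /tlift -/F -FB; apply/eqP.
have : lspan (@tensor_rel M N) (lrepr (lpi (@tensor_rel M N) r) - r).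
  by apply/lpi_eq; rewrite lreprK.
case=> s sR ->; elim: s sR => [|[a g] s IHs] sR; first by rewrite big_nil F0.
rewrite big_cons lin IHs => [|p ps]; last by apply: sR; rewrite inE ps orbT.
rewrite addr0 (_ : F g = 0) ?scaler0 //.
have /= := sR (a, g) (mem_head _ _); case: fb => f1 f2.
case=> [[b [m [m' [n ->]]]]|[b [m [n [n' ->]]]]];
  by rewrite FB lin /F !liftU !scale1r /= ?f1 ?f2 subrr.
Qed.

Lemma tlift_linear (f : M -> N -> P) : bilin f -> linear (tlift f).
Proof.
move=> fb a x y; rewrite -[x in LHS]lreprK -[y in LHS]lreprK -linearP.
by rewrite (tlift_pi fb) fglift_linear.
Qed.

Lemma tlift_tens (f : M -> N -> P) m n : bilin f -> tlift f (tens m n) = f m n.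
Proof. by move=> fb; rewrite /tens (tlift_pi fb) liftU scale1r. Qed.

End Universal.

Definition tmap (M N M' N' : lmodType k) (f : M -> M') (g : N -> N') :
  tensor M N -> tensor M' N' := tlift (fun m n => tens (f m) (g n)).

Definition tassoc (M N P : lmodType k) :
    tensor (tensor M N) P -> tensor M (tensor N P) :=
  tlift (fun t p => tlift (fun m n => tens m (tens n p)) t).

End Tensor.

Notation "M ⊗ N" := (tensor M N) (at level 40, left associativity) : type_scope.
Notation "m ⊗ n" := (tens m n) (at level 40, left associativity) : ring_scope.

Section BalancedTensor.
Variables (k : fieldType) (X Y : lmodType k) (B : Type).
Variables (ra : X -> B -> X) (la : B -> Y -> Y).

Definition btensor_rel : set (X ⊗ Y) :=
  [set r | exists x b y, r = ra x b ⊗ y - x ⊗ la b y].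

Definition btensor : lmodType k := lquot btensor_rel.

Definition btens (x : X) (y : Y) : btensor := lpi btensor_rel (x ⊗ y).

(* As for [tlift]: meaningful when [f] is bilinear and balanced,
   [f (ra x b) y = f x (la b y)]; see [blift_btens]. *)
Definition blift (P : lmodType k) (f : X -> Y -> P) (t : btensor) : P :=
  tlift f (lrepr t).

Lemma blift_btens (P : lmodType k) (f : X -> Y -> P) x y :
  bilin f -> (forall x b y, f (ra x b) y = f x (la b y)) ->
  blift f (btens x y) = f x y.
Proof.
move=> fb fbal; have lin := tlift_linear fb.
have F0 : tlift f 0 = 0.
  by have := lin (-1) 0 0; rewrite scaler0 addr0 scaleN1r addNr.
have FB (t u : X ⊗ Y) : tlift f (t - u) = tlift f t - tlift f u.
  by rewrite [t - u]addrC -(scaleN1r u) lin scaleN1r addrC.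
rewrite /blift -[RHS](tlift_tens x y fb).
apply/eqP; rewrite -subr_eq0 -FB; apply/eqP.
have : lspan btensor_rel (lrepr (btens x y) - x ⊗ y).
  by apply/lpi_eq; rewrite lreprK.
case=> s sR ->; elim: s sR => [|[a g] s IHs] sR; first by rewrite big_nil F0.
rewrite big_cons lin IHs => [|p ps]; last by apply: sR; rewrite inE ps orbT.
have /= [x' [b [y' ->]]] := sR (a, g) (mem_head _ _).
by rewrite FB !tlift_tens // fbal subrr scaler0 addr0.
Qed.

End BalancedTensor.

Record bicharacter (k : fieldType) (G : groupType) := Bicharacter {
  bichar :> G -> G -> k;
  bichar_neq0 : forall g h, bichar g h != 0;
  bicharMr : forall g h h', bichar g (h * h')%g = bichar g h * bichar g h';
  bicharMl : forall g g' h, bichar (g * g')%g h = bichar g h * bichar g' h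
}.

Section Graded.
Variables (k : fieldType) (G : groupType).

(* [gV g v]: [v] lies in the component of degree [g]. *)
Definition grading (V : lmodType k) : Type := G -> set V.

(* [V] is the (internal) direct sum of its components. *)
Record is_grading (V : lmodType k) (gV : grading V) : Prop := IsGrading {
  grading0 : forall g, gV g 0;
  gradingP : forall g (a : k) u v, gV g u -> gV g v -> gV g (a *: u + v);
  grading_span : forall v, exists s : seq (G * V),
    (forall p, p \in s -> gV p.1 p.2) /\ v = \sum_(p <- s) p.2;
  grading_free : forall (s : seq G) (f : G -> V), uniq s ->
    (forall g, gV g (f g)) -> \sum_(g <- s) f g = 0 ->
    forall g, g \in s -> f g = 0
}.

Record graded_map (V W : lmodType k) (gV : grading V) (gW : grading W)
    (f : V -> W) : Prop := GradedMap {
  graded_linear : linear f;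
  graded_deg : forall g v, gV g v -> gW g (f v)
}.

Definition tensor_grading (V W : lmodType k) (gV : grading V) (gW : grading W) :
    grading (V ⊗ W)%type := fun g =>
  lspan [set t | exists g1 g2 v w,
    [/\ (g1 * g2)%g = g, gV g1 v, gW g2 w & t = v ⊗ w]].

Definition field_grading : grading (k^o : lmodType k) :=
  fun g c => g = 1%g \/ c = 0.

(* Some decomposition of [v] into homogeneous elements, paired with their
   degrees. *)
Definition hdec (V : lmodType k) (gV : grading V) (v : V) : seq (G * V) :=
  xget [::] [set s | (forall p, p \in s -> gV p.1 p.2) /\ v = \sum_(p <- s) p.2].

(* The bilinear map sending homogeneous [v], [w] to [(|v|/|w|) f v w]
   (for [f] bilinear): see [twist_bilin] and [twistE]. *)
Definition twist (bc : bicharacter k G) (V W P : lmodType k)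
    (gV : grading V) (gW : grading W) (f : V -> W -> P) (v : V) (w : W) : P :=
  \sum_(p <- hdec gV v) \sum_(q <- hdec gW w) bc p.1 q.1 *: f p.2 q.2.

Section TwistTheory.
Variables (V W P : lmodType k) (gV : grading V) (gW : grading W).

Lemma linear_sum0 (U X : lmodType k) (f : U -> X) : linear f ->
  f 0 = 0 /\ (forall I (s : seq I) (c : I -> k) (F : I -> U),
    f (\sum_(i <- s) c i *: F i) = \sum_(i <- s) c i *: f (F i)).
Proof.
move=> lin; have f0 : f 0 = 0.
  by have := lin (-1) 0 0; rewrite scaler0 addr0 scaleN1r addNr.
split=> // I s c F; elim: s => [|i s IHs]; first by rewrite !big_nil.
by rewrite !big_cons lin IHs.
Qed.

Lemma grading_sum (hV : is_grading gV) g I (s : seq I) (Q : pred I) (F : I -> V) :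
  (forall i, Q i -> gV g (F i)) -> gV g (\sum_(i <- s | Q i) F i).
Proof.
move=> FV; elim: s => [|i s IHs]; first by rewrite big_nil; exact: grading0.
rewrite big_cons; case: ifP => // Qi.
by rewrite -[F i]scale1r; apply: gradingP => //; exact: FV.
Qed.

Lemma hsum_eq (hV : is_grading gV) (F : G -> V -> P) (s t : seq (G * V)) :
  (forall g, linear (F g)) ->
  (forall p, p \in s -> gV p.1 p.2) -> (forall p, p \in t -> gV p.1 p.2) ->
  \sum_(p <- s) p.2 = \sum_(p <- t) p.2 ->
  \sum_(p <- s) F p.1 p.2 = \sum_(p <- t) F p.1 p.2.
Proof.
move=> Flin sV tV st.
pose r := s ++ [seq (p.1, -1 *: p.2) | p <- t].
have rV p : p \in r -> gV p.1 p.2.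
  rewrite mem_cat => /orP[/sV //|/mapP[q /tV qV ->]] /=.
  by rewrite -[_ *: _]addr0; apply: gradingP => //; exact: grading0.
have r0 : \sum_(p <- r) p.2 = 0.
  rewrite big_cat big_map /= st -big_split big1_seq //= => p _.
  by rewrite scaleN1r subrr.
suff: \sum_(p <- r) F p.1 p.2 = 0.
  rewrite big_cat big_map /= => /eqP; rewrite addr_eq0 => /eqP ->.
  rewrite -sumrN; apply: eq_bigr => p _.
  have [F0 _] := linear_sum0 (Flin p.1).
  by rewrite -[_ *: _]addr0 Flin F0 addr0 scaleN1r opprK.
pose D := undup (unzip1 r).
pose h g : V := \sum_(p <- r | (p.1 == g) && (p \in r)) p.2.
have regroup (U : lmodType k) (E : G * V -> U) :
    \sum_(p <- r) E p = \sum_(g <- D) \sum_(p <- r | (p.1 == g) && (p \in r)) E p.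
  rewrite (exchange_big_dep (fun p => p \in r)) => [|g p _ /andP[] //] /=; rewrite big_seq.
  apply: eq_bigr => p pr; rewrite (eq_bigl (pred1 p.1)) => [|g]; last first.
    by rewrite pr andbT eq_sym.
  rewrite -big_filter filter_pred1_uniq ?undup_uniq ?big_seq1 //.
  by rewrite mem_undup; apply: map_f.
have h0 : forall g, g \in D -> h g = 0.
  apply: (grading_free hV) => [||]; first exact: undup_uniq.
    move=> g; apply: grading_sum => // p /andP[/eqP <- pr]; exact: rV.
  by rewrite -regroup.
rewrite regroup big1_seq // => g /h0 hg0; have [F0 FS] := linear_sum0 (Flin g).
transitivity (F g (\sum_(p <- [seq p <- r | (p.1 == g) && (p \in r)]) 1 *: p.2)).
  rewrite FS big_filter; apply: eq_bigr => p /andP[/eqP -> _].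
  by rewrite scale1r.
rewrite big_filter -[RHS]F0 -[in RHS]hg0; congr (F g _).
by apply: eq_bigr => p _; rewrite scale1r.
Qed.

Lemma hdecP (hV : is_grading gV) v :
  (forall p, p \in hdec gV v -> gV p.1 p.2) /\ v = \sum_(p <- hdec gV v) p.2.
Proof.
have [s sP] := grading_span hV v; rewrite /hdec.
by case: xgetP => [t _ //|/(_ s)].
Qed.

Lemma hdec_linear (hV : is_grading gV) (F : G -> V -> P) :
  (forall g, linear (F g)) -> linear (fun v => \sum_(p <- hdec gV v) F p.1 p.2).
Proof.
move=> Flin a u v; rewrite /=.
have [uV uE] := hdecP hV u; have [vV vE] := hdecP hV v.
have [wV wE] := hdecP hV (a *: u + v).
rewrite (hsum_eq hV (t := [seq (p.1, a *: p.2) | p <- hdec gV u] ++ hdec gV v)) //.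
- rewrite big_cat big_map scaler_sumr; congr (_ + _); apply: eq_bigr => p _.
  have [F0 _] := linear_sum0 (Flin p.1).
  by rewrite /= -[_ *: p.2]addr0 Flin F0 addr0.
- move=> p; rewrite mem_cat => /orP[/mapP[q /uV qV ->]|/vV //] /=.
  by rewrite -[_ *: _]addr0; apply: gradingP => //; exact: grading0.
by rewrite -wE big_cat big_map /= -scaler_sumr -uE -vE.
Qed.

Lemma hdec_homog (hV : is_grading gV) (F : G -> V -> P) g v :
  (forall g, linear (F g)) -> gV g v ->
  \sum_(p <- hdec gV v) F p.1 p.2 = F g v.
Proof.
move=> Flin gv; have [vV vE] := hdecP hV v.
rewrite (hsum_eq hV (t := [:: (g, v)])) ?big_seq1 //.
by move=> p; rewrite inE => /eqP ->.
Qed.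

End TwistTheory.

Lemma twist_bilin (bc : bicharacter k G) (V W P : lmodType k)
    (gV : grading V) (gW : grading W) (f : V -> W -> P) :
  is_grading gV -> is_grading gW -> bilin f -> bilin (twist bc gV gW f).
Proof.
move=> hV hW [f1 f2]; split=> [w|v]; last first.
  move=> a w w'; rewrite /twist.
  have lin : forall g v0, linear (fun w => \sum_(q <- hdec gW w) bc g q.1 *: f v0 q.2).
    move=> g v0; apply: (hdec_linear hW (F := fun h w => bc g h *: f v0 w)).
    by move=> h b x y; rewrite f2 scalerDr !scalerA mulrC.
  rewrite scaler_sumr -big_split; apply: eq_bigr => p _.
  exact: lin.
apply: (hdec_linear hV
  (F := fun g v => \sum_(q <- hdec gW w) bc g q.1 *: f v q.2)).
move=> g a u v; rewrite scaler_sumr -big_split; apply: eq_bigr => q _.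
by rewrite f1 scalerDr !scalerA mulrC.
Qed.

Lemma twistE (bc : bicharacter k G) (V W P : lmodType k)
    (gV : grading V) (gW : grading W) (f : V -> W -> P) g h v w :
  is_grading gV -> is_grading gW -> bilin f -> gV g v -> gW h w ->
  twist bc gV gW f v w = bc g h *: f v w.
Proof.
move=> hV hW [f1 f2] gv hw; rewrite /twist.
rewrite (hdec_homog hV (F := fun g v => \sum_(q <- hdec gW w) bc g q.1 *: f v q.2) _ gv).
  rewrite (hdec_homog hW (F := fun h w => bc g h *: f v w) _ hw) //.
  by move=> h' b x y; rewrite f2 scalerDr !scalerA mulrC.
move=> g' a x y; rewrite scaler_sumr -big_split; apply: eq_bigr => q _.
by rewrite f1 scalerDr !scalerA mulrC.
Qed.

End Graded.

Section ColourAlgebra.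
Variables (k : fieldType) (G : groupType).

Record is_colour_algebra (A : lmodType k) (gA : grading G A) (one : A)
    (mul : A -> A -> A) : Prop := IsColourAlgebra {
  ca_is_grading : is_grading gA;
  ca_bilin : bilin mul;
  ca_mulA : associative mul;
  ca_mul1 : left_id one mul;
  ca_mulr1 : right_id one mul;
  ca_one_deg : gA 1%g one;
  ca_mul_deg : forall g h a b, gA g a -> gA h b -> gA (g * h)%g (mul a b)
}.

(* Not built on [algType], whose inhabitants are nonzero: the zero algebra is
   a colour algebra. *)
Record colourAlgebra := ColourAlgebra {
  ca_mod :> lmodType k;
  ca_gr : grading G ca_mod;
  ca_one : ca_mod;
  ca_mul : ca_mod -> ca_mod -> ca_mod;
  ca_axioms : is_colour_algebra ca_gr ca_one ca_mul
}.

Arguments ca_gr : clear implicits.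
Arguments ca_one : clear implicits.
Arguments ca_mul : clear implicits.

Local Notation "a ** b" := (ca_mul _ a b) (at level 40, left associativity).

Record colour_algebra_hom (A A' : colourAlgebra) (f : A -> A') : Prop :=
    ColourAlgebraHom {
  cah_graded : graded_map (ca_gr A) (ca_gr A') f;
  cah_one : f (ca_one A) = ca_one A';
  cah_mul : forall a b, f (a ** b) = f a ** f b
}.

(* For [f] bilinear, the bilinear map
   (h ⊗ v, h' ⊗ w) |-> (|v|/|h'|) h h' ⊗ f v w; see [colour_mulE]. *)
Definition colour_mul (bc : bicharacter k G) (H : colourAlgebra)
    (V W P : lmodType k) (gV : grading G V) (f : V -> W -> P)
    (x : (H ⊗ V)%type) (y : (H ⊗ W)%type) : (H ⊗ P)%type :=
  tlift (fun h v => tlift (fun h' w =>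
    twist bc gV (ca_gr H) (fun v0 h0 => (h ** h0) ⊗ f v0 w) v h') y) x.

Lemma tlift_linear_fun (M N P : lmodType k) (f g F : M -> N -> P) a t :
  (forall m n, F m n = a *: f m n + g m n) ->
  tlift F t = a *: tlift f t + tlift g t.
Proof.
move=> E; rewrite /tlift; move: (lrepr t) => r.
rewrite -[r]Freeg_enum !fglift_Freeg /prelift scaler_sumr -big_split.
by apply: eq_bigr => p _ /=; rewrite E scalerDr !scalerA mulrC.
Qed.

Lemma twist_linear_fun (bc : bicharacter k G) (V W P : lmodType k)
    (gV : grading G V) (gW : grading G W) (f g F : V -> W -> P) a v w :
  (forall v w, F v w = a *: f v w + g v w) ->
  twist bc gV gW F v w = a *: twist bc gV gW f v w + twist bc gV gW g v w.
Proof.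
move=> E; rewrite /twist scaler_sumr -big_split; apply: eq_bigr => p _ /=.
rewrite scaler_sumr -big_split; apply: eq_bigr => q _ /=.
by rewrite E scalerDr !scalerA mulrC.
Qed.

Section ColourMul.
Variables (bc : bicharacter k G) (H : colourAlgebra) (V W P : lmodType k).
Variables (gV : grading G V) (f : V -> W -> P).
Hypotheses (hV : is_grading gV) (fb : bilin f).

Let hH : is_grading (ca_gr H) := ca_is_grading (ca_axioms H).
Let mb : bilin (ca_mul H) := ca_bilin (ca_axioms H).
Let F (h : H) (w : W) := fun v0 h0 => (h ** h0) ⊗ f v0 w.

Let Fb h w : bilin (F h w).
Proof.
have [t1 t2] := tens_bilin H P.
split=> [h0|v0] a x y; rewrite /F; first by rewrite fb.1 t2.
by rewrite mb.2 t1.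
Qed.

Let F_inner h v : bilin (fun h' w => twist bc gV (ca_gr H) (F h w) v h').
Proof.
have [t1 t2] := tens_bilin H P.
split=> [w|h'] a x y; first exact: (twist_bilin bc hV hH (Fb h w)).2.
by apply: twist_linear_fun => v0 h0; rewrite /F fb.2 t2.
Qed.

Let F_outer y :
  bilin (fun h v => tlift (fun h' w => twist bc gV (ca_gr H) (F h w) v h') y).
Proof.
have [t1 t2] := tens_bilin H P.
split=> [v|h] a x z; apply: tlift_linear_fun => h' w.
  by apply: twist_linear_fun => v0 h0; rewrite /F mb.1 t1.
exact: (twist_bilin bc hV hH (Fb h w)).1.
Qed.

Lemma colour_mul_bilin : bilin (colour_mul bc (H := H) gV f).
Proof.
split=> [y|x] a u v; first by rewrite /colour_mul (tlift_linear (F_outer y)).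
by apply: tlift_linear_fun => h v0; rewrite (tlift_linear (F_inner h v0)).
Qed.

Lemma colour_mul_tens h v h' w :
  colour_mul bc gV f (h ⊗ v) (h' ⊗ w) = twist bc gV (ca_gr H) (F h w) v h'.
Proof.
by rewrite /colour_mul (tlift_tens _ _ (F_outer _)) (tlift_tens _ _ (F_inner _ _)).
Qed.

Lemma colour_mulE g g' h v h' w : gV g v -> ca_gr H g' h' ->
  colour_mul bc gV f (h ⊗ v) (h' ⊗ w) = bc g g' *: ((h ** h') ⊗ f v w).
Proof. by move=> gv gh; rewrite colour_mul_tens (twistE _ hV hH (Fb h w) gv gh). Qed.

Lemma colour_mul1 h v w :
  colour_mul bc gV f (h ⊗ v) (ca_one H ⊗ w) = h ⊗ f v w.
Proof.
have bc1 g : bc g 1%g = 1.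
  apply/(mulfI (bichar_neq0 bc g 1%g)).
  by rewrite -bicharMr mulg1 mulr1.
rewrite colour_mul_tens.
have [vV vE] := hdecP hV v.
have lin := (twist_bilin bc hV hH (Fb h w)).1 (ca_one H).
have [_ E1] := linear_sum0 lin.
have [_ E2] := linear_sum0 ((Fb h w).1 (ca_one H)).
rewrite [in LHS]vE (eq_bigr (fun p => 1 *: p.2)) => [|p _]; last by rewrite scale1r.
rewrite E1 big_seq (eq_bigr (fun p => 1 *: F h w p.2 (ca_one H))); last first.
  move=> p /vV pV; rewrite (twistE _ hV hH (Fb h w) pV (ca_one_deg (ca_axioms H))).
  by rewrite bc1 !scale1r.
rewrite -big_seq -E2 (eq_bigr snd) => [|p _]; last by rewrite scale1r.
by rewrite -vE /F (ca_mulr1 (ca_axioms H)).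
Qed.

End ColourMul.

End ColourAlgebra.

Arguments ca_gr {k G} A : rename.
Arguments ca_one {k G} A : rename.
Arguments ca_mul {k G} A : rename.

Notation "a ** b" := (ca_mul _ a b) (at level 40, left associativity) : ring_scope.

Section ColourHopf.
Variables (k : fieldType) (G : groupType) (bc : bicharacter k G).

Record is_colour_hopf (H : colourAlgebra k G) (D : H -> (H ⊗ H)%type)
    (eps : H -> k^o) (S : H -> H) : Prop := IsColourHopf {
  ch_comul_graded :
    graded_map (ca_gr H) (tensor_grading (ca_gr H) (ca_gr H)) D;
  ch_counit_graded : graded_map (ca_gr H) (@field_grading k G) eps;
  ch_coassoc : forall h, tassoc (tmap D id (D h)) = tmap id D (D h);
  ch_counitl : forall h, tlift (fun x y => eps x *: y) (D h) = h;
  ch_counitr : forall h, tlift (fun x y => eps y *: x) (D h) = h;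
  ch_counit_one : eps (ca_one H) = 1;
  ch_counit_mul : forall h h', eps (h ** h') = eps h * eps h';
  ch_comul_one : D (ca_one H) = ca_one H ⊗ ca_one H;
  ch_comul_mul : forall h h',
    D (h ** h') = colour_mul bc (ca_gr H) (ca_mul H) (D h) (D h');
  ch_antipode_graded : graded_map (ca_gr H) (ca_gr H) S;
  ch_antipoder : forall h,
    tlift (fun x y => x ** S y) (D h) = eps h *: ca_one H;
  ch_antipodel : forall h,
    tlift (fun x y => S x ** y) (D h) = eps h *: ca_one H
}.

Record colourHopf := ColourHopf {
  ch_alg :> colourAlgebra k G;
  ch_comul : ch_alg -> (ch_alg ⊗ ch_alg)%type;
  ch_counit : ch_alg -> k^o;
  ch_antipode : ch_alg -> ch_alg;
  ch_axioms : is_colour_hopf ch_comul ch_counit ch_antipode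
}.

Arguments ch_comul : clear implicits.
Arguments ch_counit : clear implicits.
Arguments ch_antipode : clear implicits.

Variable H : colourHopf.

Record is_comodule (V : lmodType k) (gV : grading G V) (chi : V -> (H ⊗ V)%type) :
    Prop := IsComodule {
  cm_is_grading : is_grading gV;
  cm_graded : graded_map gV (tensor_grading (ca_gr H) gV) chi;
  cm_coassoc : forall v,
    tassoc (tmap (ch_comul H) id (chi v)) = tmap id chi (chi v);
  cm_counit : forall v, tlift (fun h w => ch_counit H h *: w) (chi v) = v
}.

Definition colinear (V W : lmodType k) (chiV : V -> (H ⊗ V)%type)
    (chiW : W -> (H ⊗ W)%type) (f : V -> W) : Prop :=
  forall v, chiW (f v) = tmap id f (chiV v).

Record comodule := Comodule {
  cm_mod :> lmodType k;
  cm_gr : grading G cm_mod;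
  cm_coact : cm_mod -> (H ⊗ cm_mod)%type;
  cm_axioms : is_comodule cm_gr cm_coact
}.

Arguments cm_gr : clear implicits.
Arguments cm_coact : clear implicits.

Section Coinvariants.
Variable V : comodule.

Definition is_coinv (v : V) : bool := `[< cm_coact V v = ca_one H ⊗ v >].

Lemma is_coinv_submod : submod_closed is_coinv.
Proof.
have lin := graded_linear (cm_graded (cm_axioms V)).
have [chi0 _] := linear_sum0 lin.
have [_ t2] := tens_bilin H V.
have [t0 _] := linear_sum0 (t2 (ca_one H)).
split; first by apply/asboolP; rewrite chi0 t0.
by move=> a u v /asboolP uP /asboolP vP; apply/asboolP; rewrite lin uP vP t2.
Qed.

HB.instance Definition _ :=
  GRing.isSubmodClosed.Build k V is_coinv is_coinv_submod.

Record coinv := Coinv { coinv_val :> V; coinvP : is_coinv coinv_val }.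

HB.instance Definition _ := [isSub for coinv_val].
HB.instance Definition _ := [Choice of coinv by <:].
HB.instance Definition _ := [SubChoice_isSubLmodule of coinv by <:].

End Coinvariants.

Record is_comodule_algebra (A : colourAlgebra k G) (chi : A -> (H ⊗ A)%type) :
    Prop := IsComoduleAlgebra {
  cca_is_comodule : is_comodule (ca_gr A) chi;
  cca_coact_one : chi (ca_one A) = ca_one H ⊗ ca_one A;
  cca_coact_mul : forall a a',
    chi (a ** a') = colour_mul bc (ca_gr A) (ca_mul A) (chi a) (chi a')
}.

Record comoduleAlgebra := ComoduleAlgebra {
  cca_alg :> colourAlgebra k G;
  cca_coact : cca_alg -> (H ⊗ cca_alg)%type;
  cca_axioms : is_comodule_algebra cca_coact
}.

Arguments cca_coact : clear implicits.

Definition alg_comodule (A : comoduleAlgebra) : comodule :=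
  Comodule (cca_is_comodule (cca_axioms A)).

Section HopfModule.
Variable A : comoduleAlgebra.

(* The data of a Hopf module, without its axioms: [induced] below is only of
   this type, so that the axioms for it can be part of a statement. *)
Record hopfData := HopfData {
  hm_mod :> lmodType k;
  hm_gr : grading G hm_mod;
  hm_act : A -> hm_mod -> hm_mod;
  hm_coact : hm_mod -> (H ⊗ hm_mod)%type
}.

Arguments hm_gr : clear implicits.
Arguments hm_act : clear implicits.
Arguments hm_coact : clear implicits.

Record is_hopf_module (M : hopfData) : Prop := IsHopfModule {
  hm_is_comodule : is_comodule (hm_gr M) (hm_coact M);
  hm_act_bilin : bilin (hm_act M);
  hm_act1 : forall m : M, hm_act M (ca_one A) m = m;
  hm_actA : forall a b (m : M), hm_act M (a ** b) m = hm_act M a (hm_act M b m);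
  hm_act_deg : forall g h a (m : M),
    ca_gr A g a -> hm_gr M h m -> hm_gr M (g * h)%g (hm_act M a m);
  hm_coact_act : forall a (m : M),
    hm_coact M (hm_act M a m) =
    colour_mul bc (ca_gr A) (hm_act M) (cca_coact A a) (hm_coact M m)
}.

Record hopfModule := HopfModule {
  hm_data :> hopfData;
  hm_axioms : is_hopf_module hm_data
}.

Record hopf_morphism (M N : hopfData) (f : M -> N) : Prop := HopfMorphism {
  hmor_graded : graded_map (hm_gr M) (hm_gr N) f;
  hmor_act : forall a m, f (hm_act M a m) = hm_act N a (f m);
  hmor_coact : colinear (hm_coact M) (hm_coact N) f
}.

Definition hopf_isomorphism (M N : hopfData) (f : M -> N) : Prop :=
  hopf_morphism f /\
  exists f' : N -> M, [/\ hopf_morphism f', cancel f f' & cancel f' f].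

Section Induced.
Variable M : hopfModule.

Definition hopf_comodule : comodule :=
  Comodule (hm_is_comodule (hm_axioms M)).

Local Notation B := (coinv (alg_comodule A)).
Local Notation McoH := (coinv hopf_comodule).

Lemma coinv_act_subproof (b : B) (m : McoH) :
  @is_coinv hopf_comodule (hm_act M (coinv_val b) (coinv_val m)).
Proof.
have /asboolP bP := coinvP b; have /asboolP mP := coinvP m.
apply/asboolP; rewrite /= (hm_coact_act (hm_axioms M)).
rewrite /= in bP mP; rewrite bP mP; apply: colour_mul1.
  exact: ca_is_grading (ca_axioms A).
exact: hm_act_bilin (hm_axioms M).
Qed.

Definition coinv_act (b : B) (m : McoH) : McoH := Coinv (coinv_act_subproof b m).

(* A ⊗_B M^coH, a quotient of A ⊗ M^coH. *)
Definition induced_mod : lmodType k :=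
  btensor (fun (a : A) (b : B) => a ** coinv_val b) coinv_act.

Definition itens (a : A) (m : McoH) : induced_mod := btens _ _ a m.

Definition induced_gr : grading G induced_mod := fun g =>
  lspan [set t | exists g1 g2 a (m : McoH),
    [/\ (g1 * g2)%g = g, ca_gr A g1 a, hm_gr M g2 (coinv_val m) & t = itens a m]].

(* The lifts are applied to unproved balanced maps; their values on pure tensors
   are to be established together with [is_hopf_module induced]. *)
Definition induced : hopfData := @HopfData induced_mod induced_gr
  (fun a => blift (fun (a' : A) (m : McoH) => itens (a ** a') m))
  (blift (fun (a : A) (m : McoH) => tmap id (fun a0 : A => itens a0 m) (cca_coact A a))).

Definition alpha : induced -> M :=
  blift (fun (a : A) (m : McoH) => hm_act M a (coinv_val m)).

End Induced.
End HopfModule.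
End ColourHopf.

Arguments ch_comul {k G bc} H : rename.
Arguments ch_counit {k G bc} H : rename.
Arguments ch_antipode {k G bc} H : rename.
Arguments cm_gr {k G bc H} V : rename.
Arguments cm_coact {k G bc H} V : rename.
Arguments cca_coact {k G bc H} A : rename.
Arguments hm_gr {k G bc H A} M : rename.
Arguments hm_act {k G bc H A} M : rename.
Arguments hm_coact {k G bc H A} M : rename.
Arguments itens {k G bc H A} M a m.

(* Main.v *)
(* Let p(m) = theta(S m_(-1)) m_(0), so that m = theta(m_(-1)) p(m_(0)). Since the
   coactions are multiplicative, the coaction of m is that of theta(m_(-1)) times
   1 ⊗ p(m_(0)); multiplying by the inverse of theta(m_(-1)) shows that p(m) is
   coinvariant. Products with 1 ⊗ p(m) carry no colour factor, so no sign
   computation (and no formula for the comultiplication of S h) is needed. The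
   inverse of alpha is m |-> theta(m_(-1)) ⊗_B p(m_(0)). As alpha and its inverse
   preserve degrees, A ⊗_B M^coH inherits from M the directness of its grading. *)
Require Import Defs.
From mathcomp Require Import all_boot all_algebra.
From mathcomp Require Import boolp classical_sets.
From mathcomp Require Import freeg.

Set Implicit Arguments.
Unset Strict Implicit.
Unset Printing Implicit Defensive.

Import GRing.Theory.
Local Open Scope ring_scope.

(** * Linear maps, bilinear maps and spans *)

Section Linear.
Variable k : fieldType.
Implicit Types U V W : lmodType k.

Lemma linear_idfun V : linear (@id V).
Proof. by []. Qed.

Lemma linear_comp U V W (f : V -> W) (g : U -> V) :
  linear f -> linear g -> linear (fun x => f (g x)).
Proof. by move=> fl gl a x y; rewrite gl fl. Qed.

Lemma linear_map0 V W (f : V -> W) : linear f -> f 0 = 0.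
Proof. by case/linear_sum0. Qed.

Lemma linear_mapZ V W (f : V -> W) : linear f -> forall a x, f (a *: x) = a *: f x.
Proof. by move=> fl a x; rewrite -[a *: x]addr0 fl linear_map0 ?addr0. Qed.

Lemma linear_mapD V W (f : V -> W) : linear f -> forall x y, f (x + y) = f x + f y.
Proof. by move=> fl x y; rewrite -[x in LHS]scale1r fl scale1r. Qed.

Lemma linear_map_sum V W (f : V -> W) I (s : seq I) (F : I -> V) :
  linear f -> f (\sum_(i <- s) F i) = \sum_(i <- s) f (F i).
Proof.
move=> fl; elim: s => [|i s IHs]; first by rewrite !big_nil linear_map0.
by rewrite !big_cons linear_mapD // IHs.
Qed.

Lemma bilin_comp U V W (U' V' : lmodType k) (f : U -> V -> W) u v :
  bilin f -> linear u -> linear v ->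
  bilin (fun (x : U') (y : V') => f (u x) (v y)).
Proof.
by case=> f1 f2 ul vl; split=> [y|x] a z z'; rewrite ?ul ?vl ?f1 ?f2.
Qed.

Lemma linear_bilin U V W (W' : lmodType k) (w : W -> W') (f : U -> V -> W) :
  linear w -> bilin f -> bilin (fun x y => w (f x y)).
Proof. by move=> wl [f1 f2]; split=> [y|x] a z z'; rewrite ?f1 ?f2 wl. Qed.

Lemma lspan_min V (S : set V) (T : V -> Prop) :
  T 0 -> (forall a u v, T u -> T v -> T (a *: u + v)) ->
  (forall v, S v -> T v) -> forall v, lspan S v -> T v.
Proof.
move=> T0 TP ST v [s sS ->]; elim: s sS => [|p s IHs] sS; first by rewrite big_nil.
rewrite big_cons; apply: TP; first by apply/ST/sS; rewrite mem_head.
by apply: IHs => q qs; apply: sS; rewrite inE qs orbT.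
Qed.

Lemma lspan0 V (S : set V) : lspan S 0.
Proof. by exists [::] => //; rewrite big_nil. Qed.

Lemma lspanP V (S : set V) a u v : lspan S u -> lspan S v -> lspan S (a *: u + v).
Proof.
move=> Su Sv; apply/asboolP; have [_ Slin] := lspan_submod S.
by apply: Slin; apply/asboolP.
Qed.

Lemma lspan_linear V W (S : set V) (T : set W) (f : V -> W) : linear f ->
  (forall v, S v -> lspan T (f v)) -> forall v, lspan S v -> lspan T (f v).
Proof.
move=> fl ST; apply: lspan_min => //; first by rewrite linear_map0 //; apply: lspan0.
by move=> a u v; rewrite fl; apply: lspanP.
Qed.

End Linear.

(** * Calculus of lifts from tensor products, in place of Sweedler notation *)

Section Tensor.
Variable k : fieldType.
Implicit Types M N P Q : lmodType k.

(** Each tensor is the class of a formal sum of pairs, hence a linear combination of pure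
    tensors. *)
Lemma tensor_ext M N P (f g : (M ⊗ N)%type -> P) : linear f -> linear g ->
  (forall m n, f (m ⊗ n) = g (m ⊗ n)) -> f =1 g.
Proof.
move=> fl gl fg t; rewrite -[t]lreprK; move: (lrepr t) => r.
rewrite -[r]freeg_sumE.
have pl : linear (lpi (@tensor_rel k M N)) by exact: lpi_is_linear.
rewrite (linear_map_sum _ _ pl) !linear_map_sum //; apply: eq_bigr => -[m n] _.
rewrite (_ : Freeg _ = coeff (m, n) r *: free_pair m n).
  by rewrite (linear_mapZ pl) !linear_mapZ // fg.
by apply/eqP/freeg_eqP => w; rewrite coeffZ !coeffU mul1r.
Qed.

Lemma eq_tlift M N P (f g : M -> N -> P) t :
  (forall m n, f m n = g m n) -> tlift f t = tlift g t.
Proof. by move=> fg; congr tlift; apply/funext => m; apply/funext. Qed.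

(** [tlift f t] stands for the Sweedler sum of [f(t_1, t_2)]; this moves a linear map inside such a
    sum. *)
Lemma linear_tlift M N P Q (u : P -> Q) (f : M -> N -> P) t :
  linear u -> bilin f -> u (tlift f t) = tlift (fun m n => u (f m n)) t.
Proof.
move=> ul fb; have ufb := linear_bilin ul fb; move: t; apply: tensor_ext.
- by apply: linear_comp ul _; apply: tlift_linear.
- exact: tlift_linear.
- by move=> m n; rewrite !tlift_tens.
Qed.

Lemma tlift_tens_id M N (t : (M ⊗ N)%type) : tlift (fun m n => m ⊗ n) t = t.
Proof.
move: t; apply: tensor_ext => // [|m n]; first exact: tlift_linear (tens_bilin _ _).
by rewrite tlift_tens //; apply: tens_bilin.
Qed.

Section Tmap.
Variables (M N M' N' : lmodType k) (u : M -> M') (v : N -> N').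
Hypotheses (ul : linear u) (vl : linear v).

Let uvb : bilin (fun m n => u m ⊗ v n).
Proof. by apply: bilin_comp => //; apply: tens_bilin. Qed.

Lemma tmap_linear : linear (tmap u v).
Proof. exact: tlift_linear. Qed.

Lemma tmap_tens m n : tmap u v (m ⊗ n) = u m ⊗ v n.
Proof. exact: tlift_tens. Qed.

Lemma tlift_tmap P (f : M' -> N' -> P) t :
  bilin f -> tlift f (tmap u v t) = tlift (fun m n => f (u m) (v n)) t.
Proof.
move=> fb; rewrite linear_tlift //; last exact: tlift_linear.
by apply: eq_tlift => m n; rewrite tlift_tens.
Qed.

End Tmap.

Lemma tmap_comp M N M' N' M'' N'' (u : M -> M') (v : N -> N')
    (u' : M' -> M'') (v' : N' -> N'') t :
  linear u -> linear v -> linear u' -> linear v' ->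
  tmap u' v' (tmap u v t) = tmap (fun x => u' (u x)) (fun x => v' (v x)) t.
Proof.
move=> *; rewrite {1}/tmap tlift_tmap //.
by apply: bilin_comp => //; apply: tens_bilin.
Qed.

Lemma eq_tmap M N M' N' (u u' : M -> M') (v v' : N -> N') t :
  u =1 u' -> v =1 v' -> tmap u v t = tmap u' v' t.
Proof. by move=> uu' vv'; apply: eq_tlift => m n; rewrite uu' vv'. Qed.

Lemma tmap_id M N (t : (M ⊗ N)%type) : tmap id id t = t.
Proof. exact: tlift_tens_id. Qed.

Definition trilin M N P Q (F : M -> N -> P -> Q) : Prop :=
  [/\ forall n p, linear (fun m => F m n p), forall m p, linear (fun n => F m n p)
    & forall m n, linear (F m n)].

Section Trilinear.
Variables (M N P Q : lmodType k) (F : M -> N -> P -> Q).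
Hypothesis Ft : trilin F.

Lemma trilin_bilinl p : bilin (fun m n => F m n p).
Proof. by case: Ft => F1 F2 _; split=> x; [apply: F1|apply: F2]. Qed.

Lemma trilin_bilinr m : bilin (F m).
Proof. by case: Ft => _ F2 F3; split=> x; [apply: F2|apply: F3]. Qed.

(** Linearity in [t] is linearity of a lift; linearity in [p] is linearity of [tlift] in the
    function being lifted. *)
Lemma trilin_tliftl : bilin (fun t p => tlift (fun m n => F m n p) t).
Proof.
split=> [p|t]; first exact: tlift_linear (trilin_bilinl p).
by move=> a p p'; apply: tlift_linear_fun => m n; case: Ft => _ _ ->.
Qed.

Lemma trilin_tliftr : bilin (fun m t => tlift (F m) t).
Proof.
split=> [t|m]; last exact: tlift_linear (trilin_bilinr m).
by move=> a p p'; apply: tlift_linear_fun => m n; case: Ft => ->.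
Qed.

End Trilinear.

Section Assoc.
Variables M N P : lmodType k.

Let tens3 : trilin (fun (m : M) (n : N) (p : P) => m ⊗ (n ⊗ p)).
Proof.
have [t1 t2] := tens_bilin M (N ⊗ P)%type; have [s1 s2] := tens_bilin N P.
by split=> x y a z z'; rewrite ?s1 ?s2 ?t1 ?t2.
Qed.

Lemma tassoc_linear : linear (@tassoc k M N P).
Proof. exact: tlift_linear (trilin_tliftl tens3). Qed.

Lemma tassoc_tens m n p : tassoc ((m ⊗ n) ⊗ p) = m ⊗ (n ⊗ p) :> (M ⊗ (N ⊗ P))%type.
Proof.
rewrite /tassoc (tlift_tens _ _ (trilin_tliftl tens3)).
by rewrite (tlift_tens _ _ (trilin_bilinl tens3 p)).
Qed.

(** On a pure tensor both sides are [F m n p]. Combined with coassociativity this rebrackets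
    iterated Sweedler sums. *)
Lemma tlift_tassoc Q (F : M -> N -> P -> Q) t : trilin F ->
  tlift (fun m => tlift (F m)) (tassoc t) =
  tlift (fun t p => tlift (fun m n => F m n p) t) t.
Proof.
move=> Ft; rewrite /tassoc linear_tlift.
- apply: eq_tlift => s p; move: s; apply: tensor_ext.
  + apply: linear_comp; first exact: tlift_linear (trilin_tliftr Ft).
    exact: (trilin_tliftl tens3).1.
  + exact: (trilin_tliftl Ft).1.
  + move=> m n; rewrite (tlift_tens _ _ (trilin_bilinl tens3 p)).
    rewrite (tlift_tens _ _ (trilin_tliftr Ft)) (tlift_tens _ _ (trilin_bilinr Ft m)).
    by rewrite (tlift_tens _ _ (trilin_bilinl Ft p)).
- exact: tlift_linear (trilin_tliftr Ft).
- exact: trilin_tliftl.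
Qed.

End Assoc.

(** Naturality of the associator in its third factor, used to carry coassociativity from [A] to the
    induced module. *)
Lemma tassoc_tmap M N P P' (f : P -> P') (t : (M ⊗ N ⊗ P)%type) : linear f ->
  tassoc (tmap id f t) = tmap id (tmap id f) (tassoc t).
Proof.
move=> fl; have idl (V : lmodType k) := @linear_idfun k V.
have fl' := tmap_linear (idl N) fl; move: t.
apply: tensor_ext => [||s p].
- by apply: linear_comp; [apply: tassoc_linear|apply: tmap_linear].
- by apply: linear_comp; [apply: tmap_linear|apply: tassoc_linear].
rewrite tmap_tens //.
have t1 (V : lmodType k) := (tens_bilin (M ⊗ N)%type V).1.
move: s; apply: tensor_ext => [||m n].
- by apply: linear_comp (t1 _ _); apply: tassoc_linear.
- apply: linear_comp; first exact: tmap_linear.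
  by apply: linear_comp (t1 _ _); apply: tassoc_linear.
- by rewrite !tassoc_tens !tmap_tens.
Qed.

End Tensor.

(** * Linear maps out of balanced tensor products *)

Section BalancedTensor.
Variables (k : fieldType) (X Y : lmodType k) (B : Type).
Variables (ra : X -> B -> X) (la : B -> Y -> Y).
Local Notation BT := (btensor ra la).

Lemma btens_bilin : bilin (btens ra la).
Proof.
have [t1 t2] := tens_bilin X Y.
by split=> [y|x] a u v; rewrite /btens ?t1 ?t2 linearP.
Qed.

Lemma btens_balanced x b y : btens ra la (ra x b) y = btens ra la x (la b y).
Proof. by apply/lpi_eq/lspan_sub; exists x, b, y. Qed.

Lemma btensor_ext (P : lmodType k) (f g : BT -> P) : linear f -> linear g ->
  (forall x y, f (btens ra la x y) = g (btens ra la x y)) -> f =1 g.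
Proof.
move=> fl gl fg t; rewrite -[t]lreprK.
have pl : linear (lpi (btensor_rel ra la)) by exact: lpi_is_linear.
move: (lrepr t) => {t}; apply: (tensor_ext (f := fun t => f (lpi _ t))) => //.
- exact: linear_comp.
- exact: linear_comp.
Qed.

(** [blift] evaluates [tlift f] at a chosen representative. It differs from [t] by a combination of
    balancing relations, and [tlift f] vanishes on these. *)
Lemma blift_pi (P : lmodType k) (f : X -> Y -> P) t :
  bilin f -> (forall x b y, f (ra x b) y = f x (la b y)) ->
  blift f (lpi (btensor_rel ra la) t) = tlift f t.
Proof.
move=> fb fbal; have lin := tlift_linear fb.
rewrite /blift -[tlift f t]add0r -[lrepr _](subrK t) (linear_mapD lin); congr (_ + _).
have : lspan (btensor_rel ra la) (lrepr (lpi (btensor_rel ra la) t) - t).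
  by apply/lpi_eq; rewrite lreprK.
apply: (lspan_min (T := fun v => tlift f v = 0)) => [|a u v|v [x [b [y ->]]]].
  exact: linear_map0.
  by rewrite lin => -> ->; rewrite scaler0 addr0.
by rewrite -scaleN1r addrC lin !tlift_tens // fbal scaleN1r addNr.
Qed.

Lemma blift_linear (P : lmodType k) (f : X -> Y -> P) :
  bilin f -> (forall x b y, f (ra x b) y = f x (la b y)) ->
  linear (blift f : BT -> P).
Proof.
move=> fb fbal a u v; rewrite -[u in LHS]lreprK -[v in LHS]lreprK -linearP.
by rewrite blift_pi // (tlift_linear fb).
Qed.

End BalancedTensor.

(** * Colour products on [H ⊗ V] and their naturality *)

Section Twist.
Variables (k : fieldType) (G : groupType) (bc : bicharacter k G).

Lemma eq_twist (V W P : lmodType k) (gV : grading G V) (gW : grading G W)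
    (f g : V -> W -> P) v w :
  (forall v w, f v w = g v w) -> twist bc gV gW f v w = twist bc gV gW g v w.
Proof.
by move=> fg; apply: eq_bigr => p _; apply: eq_bigr => q _; rewrite fg.
Qed.

Lemma linear_twist (V W P Q : lmodType k) (gV : grading G V) (gW : grading G W)
    (u : P -> Q) (f : V -> W -> P) v w : linear u ->
  u (twist bc gV gW f v w) = twist bc gV gW (fun x y => u (f x y)) v w.
Proof.
move=> ul; rewrite /twist linear_map_sum //; apply: eq_bigr => p _.
by rewrite linear_map_sum //; apply: eq_bigr => q _; rewrite linear_mapZ.
Qed.

Variables (H : colourAlgebra k G) (V : lmodType k) (gV : grading G V).
Hypothesis hV : is_grading gV.

(** The colour factor depends only on the [V]-component of [x] and the [H]-component of [y]. As [r]
    and [s] act on the other components, they pass through it even when [W] and [P] carry no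
    grading. *)
Lemma colour_mul_natural (W P W' P' : lmodType k) (f : V -> W -> P)
    (f' : V -> W' -> P') (r : W' -> W) (s : P' -> P) (x : (H ⊗ V)%type) y :
  bilin f -> bilin f' -> linear r -> linear s ->
  (forall v w, f v (r w) = s (f' v w)) ->
  colour_mul bc gV f x (tmap id r y) = tmap id s (colour_mul bc gV f' x y).
Proof.
move=> fb fb' rl sl frs; have idl := @linear_idfun k H.
have cb := colour_mul_bilin bc H hV fb.
have cb' := colour_mul_bilin bc H hV fb'.
move: x; apply: tensor_ext => [||h v]; first exact: cb.1.
  by apply: linear_comp (cb'.1 _); apply: tmap_linear.
move: y; apply: tensor_ext => [||h' w].
- by apply: linear_comp (cb.2 _) _; apply: tmap_linear.
- by apply: linear_comp _ (cb'.2 _); apply: tmap_linear.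
rewrite tmap_tens // !colour_mul_tens // linear_twist; last exact: tmap_linear.
by apply: eq_twist => v0 h0; rewrite tmap_tens // frs.
Qed.

(** The unit of [H] has degree [e], so the colour factor is trivial; [colour_mul1] gives this on
    pure tensors. *)
Lemma colour_mul_oner (W P : lmodType k) (f : V -> W -> P) (x : (H ⊗ V)%type) w :
  bilin f -> colour_mul bc gV f x (ca_one H ⊗ w) = tmap id (f^~ w) x.
Proof.
move=> fb; have fl := fb.1 w; have idl := @linear_idfun k H.
move: x; apply: tensor_ext => [||h v].
- exact: (colour_mul_bilin bc H hV fb).1.
- exact: tmap_linear.
- by rewrite colour_mul1 // tmap_tens.
Qed.

End Twist.

(** * Coassociativity and counit under a lift *)

Section Comodule.
Variables (k : fieldType) (G : groupType) (bc : bicharacter k G).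
Variables (H : colourHopf bc) (V : comodule H).

Lemma comul_linear : linear (ch_comul H).
Proof. exact: graded_linear (ch_comul_graded (ch_axioms H)). Qed.

Lemma counit_linear : linear (ch_counit H).
Proof. exact: graded_linear (ch_counit_graded (ch_axioms H)). Qed.

Lemma antipode_linear : linear (ch_antipode H).
Proof. exact: graded_linear (ch_antipode_graded (ch_axioms H)). Qed.

Lemma coact_linear : linear (cm_coact V).
Proof. exact: graded_linear (cm_graded (cm_axioms V)). Qed.

(** Applying a trilinear [F] to both sides of coassociativity removes the associator, leaving the
    Sweedler rule for [F(v_(-2), v_(-1), v_(0))]. *)
Lemma coact_coassoc_lift (Q : lmodType k) (F : H -> H -> V -> Q) v : trilin F ->
  tlift (fun h w => tlift (F h) (cm_coact V w)) (cm_coact V v) =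
  tlift (fun h w => tlift (fun h1 h2 => F h1 h2 w) (ch_comul H h)) (cm_coact V v).
Proof.
move=> Ft; have [cl dl] := (coact_linear, comul_linear).
have [idH idV] := (@linear_idfun k H, @linear_idfun k V).
rewrite -(tlift_tmap dl idV _ (trilin_tliftl Ft)) -tlift_tassoc //.
rewrite (cm_coassoc (cm_axioms V)).
by rewrite (tlift_tmap idH cl _ (trilin_tliftr Ft)).
Qed.

Lemma coact_counit_lift (Q : lmodType k) (u : V -> Q) v : linear u ->
  tlift (fun h w => ch_counit H h *: u w) (cm_coact V v) = u v.
Proof.
move=> ul; rewrite -[v in RHS](cm_counit (cm_axioms V)) linear_tlift //.
  by apply: eq_tlift => h w; rewrite linear_mapZ.
split=> [w|h] a x y; first by rewrite counit_linear scalerDl scalerA.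
by rewrite scalerDr !scalerA mulrC.
Qed.

End Comodule.

(** * Hopf modules, and coactions of products with coinvariants *)

Section HopfModule.
Variables (k : fieldType) (G : groupType) (bc : bicharacter k G).
Variables (H : colourHopf bc) (A : comoduleAlgebra H).

Lemma ca_mul_bilin (R : colourAlgebra k G) : bilin (ca_mul R).
Proof. exact: ca_bilin (ca_axioms R). Qed.

Lemma cca_is_grading : is_grading (ca_gr A).
Proof. exact: ca_is_grading (ca_axioms A). Qed.

(** [A] as a Hopf module over itself. Its coinvariants are the elements of [B], so results on Hopf
    modules apply to elements of [A] as well. *)
Definition regular_data : hopfData A :=
  HopfData (ca_gr A) (ca_mul A) (cca_coact A).

Lemma regular_is_hopf_module : is_hopf_module regular_data.
Proof.
have Aax := ca_axioms A; have cax := cca_axioms A; split.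
- exact: cca_is_comodule cax.
- exact: ca_bilin Aax.
- exact: ca_mul1 Aax.
- by move=> a b m; rewrite /= (ca_mulA Aax).
- exact: ca_mul_deg Aax.
- exact: cca_coact_mul cax.
Qed.

Definition regular : hopfModule A := HopfModule regular_is_hopf_module.

Variable M : hopfModule A.

Lemma hm_coact_linear : linear (hm_coact M).
Proof. exact: (coact_linear (V := hopf_comodule M)). Qed.

Lemma hopf_act_bilin : bilin (hm_act M).
Proof. exact: hm_act_bilin (hm_axioms M). Qed.

Lemma hm_is_grading : is_grading (hm_gr M).
Proof. exact: cm_is_grading (hm_is_comodule (hm_axioms M)). Qed.

Lemma hm_coact_coinv (m : coinv (hopf_comodule M)) :
  hm_coact M (coinv_val m) = ca_one H ⊗ coinv_val m.
Proof. exact/asboolP/(coinvP m). Qed.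

Lemma hm_coact_act_coinv a (m : coinv (hopf_comodule M)) :
  hm_coact M (hm_act M a (coinv_val m)) =
  tmap id (fun x => hm_act M x (coinv_val m)) (cca_coact A a).
Proof.
rewrite (hm_coact_act (hm_axioms M)) hm_coact_coinv colour_mul_oner //.
  exact: cca_is_grading.
exact: hopf_act_bilin.
Qed.

(** Associativity of the colour action on elements [1 ⊗ m]. Multiplying by [1 ⊗ m] amounts to
    applying [id ⊗ (a ↦ am)], so naturality suffices and the bicharacter is never expanded. *)
Lemma colour_act_oner (x y : (H ⊗ A)%type) (m : M) :
  colour_mul bc (ca_gr A) (hm_act M) x
    (colour_mul bc (ca_gr A) (hm_act M) y (ca_one H ⊗ m)) =
  colour_mul bc (ca_gr A) (hm_act M)
    (colour_mul bc (ca_gr A) (ca_mul A) x y) (ca_one H ⊗ m).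
Proof.
have [hA [ab mb]] := (cca_is_grading, (hopf_act_bilin, ca_mul_bilin A)).
rewrite !colour_mul_oner //; apply: colour_mul_natural => //; first exact: ab.1.
  exact: ab.1.
by move=> a b; rewrite (hm_actA (hm_axioms M)).
Qed.

End HopfModule.

(** * The projection [p], here [coinv_proj], onto the coinvariants *)

Section Projection.
Variables (k : fieldType) (G : groupType) (bc : bicharacter k G).
Variables (H : colourHopf bc) (A : comoduleAlgebra H) (theta : H -> A).
Hypothesis theta_colinear : colinear (ch_comul H) (cca_coact A) theta.
Hypothesis theta_hom : colour_algebra_hom theta.

Let theta_linear : linear theta.
Proof. exact: graded_linear (cah_graded theta_hom). Qed.

Section Module.
Variable M : hopfModule A.

Definition coinv_proj (m : M) : M :=
  tlift (fun h v => hm_act M (theta (ch_antipode H h)) v) (hm_coact M m).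

Lemma theta_act_bilin : bilin (fun h (v : M) => hm_act M (theta h) v).
Proof. by apply: bilin_comp => //; apply: hopf_act_bilin. Qed.

Lemma coinv_proj_bilin :
  bilin (fun h (v : M) => hm_act M (theta (ch_antipode H h)) v).
Proof.
apply: (bilin_comp (v := id) theta_act_bilin) => //; exact: antipode_linear.
Qed.

Lemma coinv_proj_linear : linear coinv_proj.
Proof.
move=> a x y; rewrite /coinv_proj hm_coact_linear.
exact: tlift_linear coinv_proj_bilin _ _ _.
Qed.

(** By coassociativity and multiplicativity of [theta], the left side is
    [theta(m_(-2) S(m_(-1))) m_(0)]. The antipode and counit axioms reduce it to [m]. *)
Lemma theta_coinv_proj m :
  tlift (fun h v => hm_act M (theta h) (coinv_proj v)) (hm_coact M m) = m.
Proof.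
have [a1 a2] := hopf_act_bilin M; have Sl := @antipode_linear _ _ _ H.
pose F h h' (v : M) := hm_act M (theta h) (hm_act M (theta (ch_antipode H h')) v).
have Ft : trilin F.
  by split=> x y a z z'; rewrite /F ?Sl ?theta_linear ?a1 ?a2 ?a1 ?a2.
transitivity (tlift (fun h v => tlift (F h) (hm_coact M v)) (hm_coact M m)).
  apply: eq_tlift => h v; rewrite linear_tlift //; exact: coinv_proj_bilin.
rewrite (coact_coassoc_lift (V := hopf_comodule M) m Ft).
(* The right-hand [m] is expanded by the counit, so that both sides are lifts evaluated at
   [hm_coact M m]. *)
rewrite -[RHS](coact_counit_lift (V := hopf_comodule M) m (@linear_idfun k M)).
apply: eq_tlift => h v.
transitivity (hm_act M (theta (tlift (fun x y => x ** ch_antipode H y) (ch_comul H h))) v).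
  rewrite (linear_tlift (u := fun x => hm_act M (theta x) v)).
  - by apply: eq_tlift => x y; rewrite (cah_mul theta_hom) (hm_actA (hm_axioms M)).
  - exact: theta_act_bilin.1.
  - by apply: (bilin_comp (u := id)) => //; apply: ca_mul_bilin.
rewrite (ch_antipoder (ch_axioms H)) (linear_mapZ (theta_act_bilin.1 v)).
by rewrite (cah_one theta_hom) (hm_act1 (hm_axioms M)).
Qed.

(** Colinearity of [theta] enters here: it gives [theta(h)] the coaction [h_1 ⊗ theta(h_2)]. *)
Lemma coact_theta (h : H) (m : M) :
  colour_mul bc (ca_gr A) (hm_act M) (cca_coact A (theta h)) (ca_one H ⊗ m) =
  tlift (fun h1 h2 => h1 ⊗ hm_act M (theta h2) m) (ch_comul H h).
Proof.
have [ab tb] := (hopf_act_bilin M, theta_act_bilin).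
rewrite colour_mul_oner //; last exact: cca_is_grading.
by rewrite theta_colinear tmap_comp //; apply: ab.1.
Qed.

(** By [coact_theta] and coassociativity the left side is [m_(-2) ⊗ theta(m_(-1)) p(m_(0))], and
    [theta_coinv_proj] applies in the second factor. Coinvariance of [p] is not presupposed, so it
    can be deduced from this. *)
Lemma coact_theta_coinv_proj m :
  tlift (fun h v => colour_mul bc (ca_gr A) (hm_act M) (cca_coact A (theta h))
    (ca_one H ⊗ coinv_proj v)) (hm_coact M m) = hm_coact M m.
Proof.
have [t1 t2] := tens_bilin H M; have [a1 a2] := theta_act_bilin.
have pl := coinv_proj_linear.
pose F (h h' : H) (v : M) := h ⊗ hm_act M (theta h') (coinv_proj v).
have Ft : trilin F.
  by split=> x y a z z'; rewrite /F ?pl ?a1 ?a2 ?t1 ?t2.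
rewrite (eq_tlift (g := fun h v => tlift (fun h1 h2 => F h1 h2 v) (ch_comul H h))).
  rewrite -(coact_coassoc_lift (V := hopf_comodule M) m Ft) -[RHS]tlift_tens_id.
  apply: eq_tlift => h v; rewrite -[v in RHS]theta_coinv_proj linear_tlift //.
  by split=> [w|x] a z z'; rewrite ?pl ?a1 ?a2.
by move=> h v; rewrite coact_theta.
Qed.

(* Coaction is multiplicative, so by [coact_theta_coinv_proj] the coaction of
   [theta (S m_(-1)) m_(0)] is the product of the coactions of
   [theta (S m_(-2)) theta (m_(-1))] and [1 ⊗ coinv_proj m_(0)]. *)
Lemma coinv_proj_coinv m : hm_coact M (coinv_proj m) = ca_one H ⊗ coinv_proj m.
Proof.
have [Sl pl] := (@antipode_linear _ _ _ H, coinv_proj_linear).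
have [t1 t2] := tens_bilin H M; have [m1 m2] := ca_mul_bilin H.
have cl := graded_linear (cm_graded (cca_is_comodule (cca_axioms A))).
have [c1 c2] := colour_mul_bilin bc H (cca_is_grading A) (hopf_act_bilin M).
rewrite linear_tlift; [|exact: hm_coact_linear|exact: coinv_proj_bilin].
pose F h h' (v : M) := colour_mul bc (ca_gr A) (hm_act M)
  (cca_coact A (theta (ch_antipode H h))) (colour_mul bc (ca_gr A) (hm_act M)
  (cca_coact A (theta h')) (ca_one H ⊗ coinv_proj v)).
have Ft : trilin F.
  by split=> x y a z z'; rewrite /F ?Sl ?pl ?t2 ?theta_linear ?cl ?c1 ?c2 ?c1 ?c2.
transitivity (tlift (fun h v => tlift (F h) (hm_coact M v)) (hm_coact M m)).
  apply: eq_tlift => h v; rewrite (hm_coact_act (hm_axioms M)).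
  rewrite -[in LHS](coact_theta_coinv_proj v) linear_tlift //.
  by split=> [w|x] a z z'; rewrite ?pl ?t2 ?theta_linear ?cl ?c1 ?c2.
rewrite (coact_coassoc_lift (V := hopf_comodule M) m Ft).
(* [1 ⊗ p(m)] becomes the sum of [eps(m_(-1)) (1 ⊗ p(m_(0)))], to be compared with the left side
   term by term. *)
rewrite -[RHS](coact_counit_lift (V := hopf_comodule M) m (linear_comp (t2 _) pl)).
apply: eq_tlift => h v.
pose E x := colour_mul bc (ca_gr A) (hm_act M) (cca_coact A (theta x))
  (ca_one H ⊗ coinv_proj v).
have El : linear E by move=> a x y; rewrite /E theta_linear cl c1.
(* The two nested colour products combine into [E(S(h_1) h_2)], because [theta] and the coaction of
   [A] are multiplicative; the antipode axiom turns this into [eps(h) E(1)]. *)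
transitivity (E (tlift (fun x y => ch_antipode H x ** y) (ch_comul H h))).
  rewrite linear_tlift //; last by apply: (bilin_comp (v := id)).
  apply: eq_tlift => x y; rewrite /F colour_act_oner /E (cah_mul theta_hom).
  by rewrite (cca_coact_mul (cca_axioms A)).
rewrite (ch_antipodel (ch_axioms H)) (linear_mapZ El); congr (_ *: _).
rewrite /E (cah_one theta_hom) (cca_coact_one (cca_axioms A)) colour_mul_oner //.
- rewrite tmap_tens //; first by rewrite (hm_act1 (hm_axioms M)).
  exact: (hopf_act_bilin M).1.
- exact: cca_is_grading.
- exact: hopf_act_bilin.
Qed.

Lemma is_coinv_proj m : is_coinv (V := hopf_comodule M) (coinv_proj m).
Proof. exact/asboolP/coinv_proj_coinv. Qed.

Definition to_coinv (m : M) : coinv (hopf_comodule M) := Coinv (is_coinv_proj m).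

Lemma to_coinv_linear : linear to_coinv.
Proof.
move=> a x y; apply: val_inj; exact: coinv_proj_linear.
Qed.

End Module.

(** Since [m] is coinvariant, [am] has coaction [a_(-1) ⊗ a_(0) m], so the projection affects [a]
    alone. With [p(a)] in [B], this lets [p(a)] cross the balanced tensor sign. *)
Lemma coinv_proj_act (M : hopfModule A) a (m : coinv (hopf_comodule M)) :
  coinv_proj (hm_act M a (coinv_val m)) =
  hm_act M (coinv_proj (M := regular A) a) (coinv_val m).
Proof.
have [ab pb] := (hopf_act_bilin M, coinv_proj_bilin (regular A)).
rewrite {1}/coinv_proj hm_coact_act_coinv tlift_tmap //.
- rewrite (linear_tlift _ (ab.1 _) pb).
  by apply: eq_tlift => h v; rewrite /= (hm_actA (hm_axioms M)).
- exact: ab.1.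
- exact: coinv_proj_bilin.
Qed.

End Projection.

(** * Degrees of lifts, and transport of gradings *)

Section GradedMaps.
Variables (k : fieldType) (G : groupType).

(* [T] is not asked to be part of a grading, so that this applies to
   [induced_gr] before it is known to be one. *)
Lemma tlift_deg (V W P : lmodType k) (gV : grading G V) (gW : grading G W)
    (f : V -> W -> P) (T : P -> Prop) g t : bilin f ->
  T 0 -> (forall a u v, T u -> T v -> T (a *: u + v)) ->
  (forall g1 g2 v w, (g1 * g2)%g = g -> gV g1 v -> gW g2 w -> T (f v w)) ->
  tensor_grading gV gW g t -> T (tlift f t).
Proof.
move=> fb T0 TP fT; have fl := tlift_linear fb.
apply: (lspan_min (T := fun t => T (tlift f t))).
- by rewrite linear_map0.
- by move=> a u v; rewrite fl; apply: TP.
- by move=> _ [g1 [g2 [v [w [gE vg wg ->]]]]]; rewrite tlift_tens //; apply: fT gE vg wg.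
Qed.

(** [gV] is at first only a family of subsets. Mutually inverse degree-preserving maps identify its
    members with the components of [W], and each grading axiom is pulled back. *)
Lemma is_grading_transport (V W : lmodType k) (gV : grading G V) (gW : grading G W)
    (f : V -> W) (f' : W -> V) :
  graded_map gV gW f -> graded_map gW gV f' -> cancel f f' -> cancel f' f ->
  is_grading gW -> is_grading gV.
Proof.
move=> [fl fd] [fl' fd'] fK fK' hW.
have back g v : gW g (f v) -> gV g v by move=> /fd'; rewrite fK.
split=> [g|g a u v gu gv|v|s F sU FV Fs0 g gs].
- by apply: back; rewrite linear_map0 //; apply: grading0.
- by apply: back; rewrite fl; apply: gradingP => //; apply: fd.
- have [s [sW fvE]] := grading_span hW (f v).
  exists [seq (p.1, f' p.2) | p <- s]; split.
    by move=> _ /mapP[p /sW pW ->] /=; apply: fd'.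
  by rewrite big_map -[v]fK fvE linear_map_sum.
- rewrite -[F g]fK (grading_free hW (s := s) (f := fun g => f (F g))) //.
  + exact: linear_map0.
  + by move=> h; apply: fd.
  + by rewrite -linear_map_sum // Fs0 linear_map0.
Qed.

End GradedMaps.

(** * Inverses of Hopf module morphisms *)

Section HopfIso.
Variables (k : fieldType) (G : groupType) (bc : bicharacter k G).
Variables (H : colourHopf bc) (A : comoduleAlgebra H).

(** Compatibility of [f'] with action and coaction follows formally from that of [f]; its linearity
    and degree preservation are supplied by the hypothesis on [f']. *)
Lemma hopf_isomorphism_inverse (M N : hopfData A) (f : M -> N) (f' : N -> M) :
  linear (hm_coact M) -> hopf_morphism f -> graded_map (hm_gr N) (hm_gr M) f' ->
  cancel f f' -> cancel f' f -> hopf_isomorphism f.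
Proof.
move=> cl fm f'g fK fK'; split=> //; exists f'; split=> //.
have [[fl _] fa fc] := fm; have f'l := graded_linear f'g.
have idl := @linear_idfun k H.
split=> // [a n|n]; first by rewrite -{1}[n]fK' -fa fK.
rewrite -{2}[n]fK' fc tmap_comp // -[LHS]tmap_id.
by apply: eq_tmap => // m; rewrite fK.
Qed.

End HopfIso.

(** * The induced module, its structure maps and [alpha] *)

Section Induced.
Variables (k : fieldType) (G : groupType) (bc : bicharacter k G).
Variables (H : colourHopf bc) (A : comoduleAlgebra H) (M : hopfModule A).
Local Notation McoH := (coinv (hopf_comodule M)).

Lemma coinv_val_linear (V : comodule H) : linear (@coinv_val _ _ _ _ V).
Proof. by []. Qed.

Lemma itens_bilin : bilin (itens M).
Proof. exact: btens_bilin. Qed.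

Lemma itens_balanced a (b : coinv (alg_comodule A)) (m : McoH) :
  itens M (a ** coinv_val b) m = itens M a (coinv_act b m).
Proof. exact: btens_balanced. Qed.

Lemma induced_ext (P : lmodType k) (f g : induced M -> P) : linear f -> linear g ->
  (forall a m, f (itens M a m) = g (itens M a m)) -> f =1 g.
Proof. exact: btensor_ext. Qed.

Lemma coact_alg_linear : linear (cca_coact A).
Proof. exact: (coact_linear (V := alg_comodule A)). Qed.

Let ab_bilin (a : A) : bilin (fun a' (m : McoH) => itens M (a ** a') m).
Proof.
by apply: (bilin_comp (v := id)) itens_bilin _ _ => //; apply: (ca_mul_bilin A).2.
Qed.

Let ab_balanced (a a' : A) (b : coinv (alg_comodule A)) (m : McoH) :
  itens M (a ** (a' ** coinv_val b)) m = itens M (a ** a') (coinv_act b m).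
Proof. by rewrite -itens_balanced (ca_mulA (ca_axioms A)). Qed.

(** The lift takes its expected value because [ab_bilin] and [ab_balanced] make it descend to the
    quotient. *)
Lemma induced_act_itens a a' (m : McoH) :
  hm_act (induced M) a (itens M a' m) = itens M (a ** a') m.
Proof.
exact: (blift_btens (f := fun a' (m : McoH) => itens M (a ** a') m)).
Qed.

Lemma induced_act_bilin : bilin (hm_act (induced M)).
Proof.
have lin a : linear (hm_act (induced M) a) by apply: blift_linear.
have [i1 i2] := itens_bilin; have [m1 m2] := ca_mul_bilin A.
split=> // t c a a'; move: t; apply: induced_ext => //.
  by move=> d x y; rewrite !lin !scalerDr !scalerA mulrC addrACA.
by move=> b m; rewrite !induced_act_itens m1 i1.
Qed.

Let coact_fun_bilin :
  bilin (fun a (m : McoH) => tmap id (fun x : A => itens M x m) (cca_coact A a)).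
Proof.
have [i1 i2] := itens_bilin; have [t1 t2] := tens_bilin H (induced_mod M).
have idl := @linear_idfun k H.
split=> [m|a] c x y.
  by rewrite coact_alg_linear tmap_linear //; apply: i1.
by apply: tlift_linear_fun => h v; rewrite i2 t2.
Qed.

(** An element of [B] has coaction [1 ⊗ b], which brings no colour factor. The resulting right
    [B]-linearity makes the induced coaction balanced. *)
Lemma coact_mul_coinv a (b : coinv (alg_comodule A)) :
  cca_coact A (a ** coinv_val b) = tmap id (fun x => x ** coinv_val b) (cca_coact A a).
Proof.
rewrite (cca_coact_mul (cca_axioms A)).
have /asboolP /= -> := coinvP b; apply: colour_mul_oner; first exact: cca_is_grading.
exact: ca_mul_bilin.
Qed.

Let coact_fun_balanced (a : A) (b : coinv (alg_comodule A)) (m : McoH) :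
  tmap id (fun x : A => itens M x m) (cca_coact A (a ** coinv_val b)) =
  tmap id (fun x : A => itens M x (coinv_act b m)) (cca_coact A a).
Proof.
rewrite coact_mul_coinv tmap_comp //; last 2 first.
- exact: (ca_mul_bilin A).1.
- exact: itens_bilin.1.
by apply: eq_tmap => // x; rewrite itens_balanced.
Qed.

Lemma induced_coact_itens a (m : McoH) :
  hm_coact (induced M) (itens M a m) =
  tmap id (fun x : A => itens M x m) (cca_coact A a).
Proof.
exact: (blift_btens
  (f := fun a (m : McoH) => tmap id (fun x : A => itens M x m) (cca_coact A a))).
Qed.

Lemma induced_coact_linear : linear (hm_coact (induced M)).
Proof. exact: blift_linear. Qed.

Let alpha_bilin : bilin (fun a (m : McoH) => hm_act M a (coinv_val m)).
Proof.
by have [b1 b2] := hopf_act_bilin M; split=> [m|a] c x y; rewrite ?coinv_val_linear ?b1 ?b2.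
Qed.

Let alpha_balanced (a : A) (b : coinv (alg_comodule A)) (m : McoH) :
  hm_act M (a ** coinv_val b) (coinv_val m) = hm_act M a (coinv_val (coinv_act b m)).
Proof. by rewrite (hm_actA (hm_axioms M)). Qed.

Lemma alpha_itens a (m : McoH) : alpha (itens M a m) = hm_act M a (coinv_val m).
Proof. exact: (blift_btens (f := fun a (m : McoH) => hm_act M a (coinv_val m))). Qed.

Lemma alpha_linear : linear (@alpha _ _ _ _ _ M).
Proof. exact: blift_linear. Qed.

Lemma induced_gr_itens g1 g2 a (m : McoH) : ca_gr A g1 a ->
  hm_gr M g2 (coinv_val m) -> hm_gr (induced M) (g1 * g2)%g (itens M a m).
Proof. by move=> ga gm; apply: lspan_sub; exists g1, g2, a, m. Qed.

Lemma alpha_graded : graded_map (hm_gr (induced M)) (hm_gr M) (@alpha _ _ _ _ _ M).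
Proof.
have hM := hm_is_grading M; split=> [|g]; first exact: alpha_linear.
apply: (lspan_min (T := fun t => hm_gr M g (alpha t))).
- by rewrite (linear_map0 alpha_linear); apply: grading0.
- by move=> a u v; rewrite alpha_linear; apply: gradingP.
- move=> _ [g1 [g2 [a [m [<- ga gm ->]]]]]; rewrite alpha_itens.
  exact: hm_act_deg (hm_axioms M) _ _ _ _ ga gm.
Qed.

(** For coinvariant [m], the coaction of [am] is [a_(-1) ⊗ a_(0) m], which is the image of the
    induced coaction under [id ⊗ alpha]. *)
Lemma alpha_morphism : hopf_morphism (M := induced M) (N := M) (@alpha _ _ _ _ _ M).
Proof.
have [al ag] := (alpha_linear, alpha_graded); have [b1 b2] := hopf_act_bilin M.
have [i1 i2] := itens_bilin; have idl := @linear_idfun k H.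
have icl := induced_coact_linear; have cl := @hm_coact_linear _ _ _ _ _ M.
split=> // [a|].
  apply: induced_ext => [||a' m].
  - by apply: linear_comp al _; apply: induced_act_bilin.2.
  - exact: linear_comp.
  - by rewrite induced_act_itens !alpha_itens (hm_actA (hm_axioms M)).
apply: induced_ext => [||a m].
- exact: linear_comp.
- by apply: linear_comp icl; apply: tmap_linear.
- rewrite alpha_itens hm_coact_act_coinv induced_coact_itens tmap_comp //.
  by apply: eq_tmap => // x; rewrite alpha_itens.
Qed.

Lemma induced_coact_deg g t : hm_gr (induced M) g t ->
  tensor_grading (ca_gr H) (hm_gr (induced M)) g (hm_coact (induced M) t).
Proof.
apply: lspan_linear; first exact: induced_coact_linear.
move=> _ [g1 [g2 [a [m [<- ga gm ->]]]]]; rewrite induced_coact_itens.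
have cg := graded_deg (cm_graded (cca_is_comodule (cca_axioms A))) ga.
apply: (tlift_deg (f := fun h x => h ⊗ itens M x m)) cg => [|||h1 h2 h x <- hh hx].
- exact: (bilin_comp (u := id) (tens_bilin _ _) _ (itens_bilin.1 m)).
- exact: lspan0.
- by move=> c u v; apply: lspanP.
(* The degree [g2] of [m] joins that of [a_(0)]; associativity of [G] recovers the total degree. *)
- apply: lspan_sub; exists h1, (h2 * g2)%g, h, (itens M x m).
  by split=> //; [rewrite mulgA|apply: induced_gr_itens].
Qed.

(** The grading is a hypothesis because its directness is known only once [alpha] has a graded
    inverse. The comodule identities are inherited from [A] on pure tensors. *)
Lemma induced_is_comodule : is_grading (hm_gr (induced M)) ->
  is_comodule (hm_gr (induced M)) (hm_coact (induced M)).
Proof.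
move=> hI; have [icl dl] := (induced_coact_linear, @comul_linear _ _ _ H).
have [il cl] := (itens_bilin.1, coact_alg_linear).
have [idH idA idI] := And3 (@linear_idfun k H) (@linear_idfun k A) (@linear_idfun k (induced M)).
have cax := cca_is_comodule (cca_axioms A).
split=> //.
- by split=> // g v; apply: induced_coact_deg.
- apply: induced_ext => [||a m].
  + apply: linear_comp; first exact: tassoc_linear.
    exact: linear_comp (tmap_linear dl idI) icl.
  + exact: linear_comp (tmap_linear idH icl) icl.
  + rewrite induced_coact_itens !tmap_comp //.
    (* The map into the induced module is pulled outside, so that it can pass the associator and
       leave the coassociativity of [A]. *)
    transitivity (tassoc (tmap id (fun x : A => itens M x m)
        (tmap (ch_comul H) id (cca_coact A a)))).
      by rewrite tmap_comp.
    rewrite tassoc_tmap // (cm_coassoc cax) tmap_comp //; last exact: tmap_linear.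
    by apply: eq_tmap => // x; rewrite induced_coact_itens.
- have cb (V : lmodType k) : bilin (fun h (v : V) => ch_counit H h *: v).
    split=> [v|h] a x y; first by rewrite counit_linear scalerDl scalerA.
    by rewrite scalerDr !scalerA mulrC.
  apply: induced_ext => [||a m] //.
    exact: linear_comp (tlift_linear (cb _)) icl.
  rewrite induced_coact_itens (tlift_tmap idH (il m) _ (cb _)).
  exact: (coact_counit_lift (V := alg_comodule A) a (il m)).
Qed.

Lemma induced_is_hopf_module : is_grading (hm_gr (induced M)) ->
  is_hopf_module (induced M).
Proof.
move=> hI; have [act1 act2] := induced_act_bilin; have il := itens_bilin.1.
have hA := cca_is_grading A; have cb := colour_mul_bilin bc H hA induced_act_bilin.
split.
- exact: induced_is_comodule.
- exact: induced_act_bilin.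
- apply: induced_ext => // a m.
  by rewrite induced_act_itens (ca_mul1 (ca_axioms A)).
- move=> a b; apply: induced_ext => // [|c m]; first exact: linear_comp.
  by rewrite !induced_act_itens (ca_mulA (ca_axioms A)).
- move=> g h a t ga; apply: lspan_linear => // _ [g1 [g2 [b [m [<- gb gm ->]]]]].
  rewrite induced_act_itens mulgA; apply: induced_gr_itens => //.
  exact: ca_mul_deg (ca_axioms A) _ _ _ _ ga gb.
- move=> a; apply: induced_ext => [||b m].
  + exact: linear_comp induced_coact_linear (act2 a).
  + exact: linear_comp (cb.2 _) induced_coact_linear.
  + rewrite induced_act_itens !induced_coact_itens (cca_coact_mul (cca_axioms A)).
    (* The map [b ↦ b ⊗ m] intertwines multiplication in [A] with the induced action; naturality
       transfers multiplicativity of the coaction. *)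
    symmetry; apply: colour_mul_natural => //; last 1 first.
    * by move=> x y; rewrite induced_act_itens.
    * exact: ca_mul_bilin.
Qed.

End Induced.

(** * The inverse of [alpha] and its degree *)

Section Inverse.
Variables (k : fieldType) (G : groupType) (bc : bicharacter k G).
Variables (H : colourHopf bc) (A : comoduleAlgebra H) (theta : H -> A).
Hypothesis theta_colinear : colinear (ch_comul H) (cca_coact A) theta.
Hypothesis theta_hom : colour_algebra_hom theta.
Variable M : hopfModule A.

Let theta_linear : linear theta.
Proof. exact: graded_linear (cah_graded theta_hom). Qed.

Lemma coinv_proj_deg g (m : M) : hm_gr M g m -> hm_gr M g (coinv_proj theta m).
Proof.
move=> gm; have hM := hm_is_grading M.
have cg := graded_deg (cm_graded (hm_is_comodule (hm_axioms M))) gm.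
apply: tlift_deg cg => [|||g1 g2 h v <- gh gv]; first exact: coinv_proj_bilin.
- exact: grading0.
- exact: gradingP.
- apply: (hm_act_deg (hm_axioms M)) gv; apply: (graded_deg (cah_graded theta_hom)).
  exact: (graded_deg (ch_antipode_graded (ch_axioms H))).
Qed.

Definition alpha_inv (m : M) : induced M :=
  tlift (fun h v => itens M (theta h) (to_coinv theta_colinear theta_hom v))
    (hm_coact M m).

Lemma alpha_inv_bilin :
  bilin (fun h (v : M) => itens M (theta h) (to_coinv theta_colinear theta_hom v)).
Proof. by apply: bilin_comp (itens_bilin M) _ _ => //; apply: to_coinv_linear. Qed.

Lemma alpha_inv_graded : graded_map (hm_gr M) (hm_gr (induced M)) alpha_inv.
Proof.
split=> [a x y|g m gm].
  by rewrite /alpha_inv hm_coact_linear (tlift_linear alpha_inv_bilin).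
have cg := graded_deg (cm_graded (hm_is_comodule (hm_axioms M))) gm.
apply: tlift_deg alpha_inv_bilin _ _ _ cg => [||g1 g2 h v <- gh gv].
- exact: lspan0.
- by move=> c u v; apply: lspanP.
- apply: induced_gr_itens; first exact: (graded_deg (cah_graded theta_hom)).
  exact: coinv_proj_deg.
Qed.

(** Once [alpha] is moved inside the lift, this is [theta_coinv_proj]. *)
Lemma alpha_invK : cancel alpha_inv (@alpha _ _ _ _ _ M).
Proof.
move=> m; rewrite /alpha_inv (linear_tlift _ (@alpha_linear _ _ _ _ _ M) alpha_inv_bilin).
rewrite -[RHS](theta_coinv_proj theta_hom); apply: eq_tlift => h v.
by rewrite alpha_itens.
Qed.

(** On [a ⊗ m] the composite is [theta(a_(-1)) ⊗ p(a_(0)) m], by [coinv_proj_act]. Moving [p(a_(0))]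
    to the left factor gives [a ⊗ m], by [theta_coinv_proj] in [regular A]. *)
Lemma alphaK : cancel (@alpha _ _ _ _ _ M) alpha_inv.
Proof.
have [il bl] := (graded_linear alpha_inv_graded, hopf_act_bilin M).
apply: induced_ext => // [|a m]; first exact: linear_comp il (@alpha_linear _ _ _ _ _ M).
rewrite alpha_itens /alpha_inv hm_coact_act_coinv tlift_tmap //; last 2 first.
- exact: bl.1.
- exact: alpha_inv_bilin.
rewrite -[a in RHS](theta_coinv_proj (M := regular A) theta_hom).
rewrite (linear_tlift _ ((itens_bilin M).1 m)); last first.
  apply: (bilin_comp (u := theta)) (ca_mul_bilin A) _ _ => //.
  exact: (coinv_proj_linear theta_hom (M := regular A)).
apply: eq_tlift => h x /=.
(* The projection of [x], computed in the regular module, is packaged as an element of [B] so that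
   balancing applies. *)
pose b : coinv (alg_comodule A) :=
  @Coinv _ _ _ _ (alg_comodule A) (coinv_proj (M := regular A) theta x)
    (is_coinv_proj (M := regular A) theta_colinear theta_hom x).
rewrite -[coinv_proj (M := regular A) theta x]/(coinv_val b) itens_balanced.
congr (itens M _ _).
by apply: val_inj; apply: coinv_proj_act.
Qed.

End Inverse.

Theorem theorem3p13 (k : fieldType) (G : groupType)
    (mulgC : forall g h : G, (g * h)%g = (h * g)%g)
    (bc : bicharacter k G) (H : colourHopf bc) (A : comoduleAlgebra H)
    (theta : H -> A)
    (theta_colinear : colinear (ch_comul H) (cca_coact A) theta)
    (theta_hom : colour_algebra_hom theta)
    (M : hopfModule A) :
  [/\ (forall a a' (m : coinv (hopf_comodule M)),
         hm_act (induced M) a (itens M a' m) = itens M (a ** a') m),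
      (forall a (m : coinv (hopf_comodule M)),
         hm_coact (induced M) (itens M a m) =
         tmap id (fun a0 : A => itens M a0 m) (cca_coact A a)),
      is_hopf_module (induced M),
      (forall a (m : coinv (hopf_comodule M)),
         alpha (itens M a m) = hm_act M a (coinv_val m)) &
      hopf_isomorphism (@alpha _ _ _ _ _ M)].
Proof.
have ag := alpha_graded M; have am := alpha_morphism M.
have bg := alpha_inv_graded theta_colinear theta_hom M.
have aK := alphaK theta_colinear theta_hom (M := M).
have bK := alpha_invK theta_colinear theta_hom (M := M).
split.
- exact: induced_act_itens.
- exact: induced_coact_itens.
(* Directness of the induced grading is transported from [M] along [alpha]. *)
- apply: induced_is_hopf_module; apply: is_grading_transport ag bg aK bK _.
  exact: hm_is_grading.
- exact: alpha_itens.
- exact: hopf_isomorphism_inverse (@induced_coact_linear _ _ _ _ _ M) am bg aK bK.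
Qed.
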